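(* Let $N\ge 0$ be an integer, let $p\in PC_N$ (a strictly positive step function on $\mathbb{R}$ with $N$ jumps), let $A_p$ be the self-adjoint realization on $L^2(\mathbb{R})$ of the Sturm--Liouville expression $\tau_p f=-(pf')'$, and let $\Omega>0$. Let $f,g\in PW_\Omega(A_p)$ be real valued and such that $|f|=|g|$ on $\mathbb{R}$. Then $f=g$ or $f=-g$.
   Context: $L^2(\mathbb{R})$ is the space of complex-valued square-integrable functions on $\mathbb{R}$. $PC_N$: $p\in PC_N$ means that $p$ is a step function with $N$ jumps, i.e. there are points $x_0=-\infty<x_1<\cdots<x_N<x_{N+1}=+\infty$ (with $x_1,\dots,x_N$ the jump points) and constants $p_0,\dots,p_N>0$ such that $p(x)=p_j$ for $x\in I_j:=(x_j,x_{j+1})$, $j=0,\dots,N$. Operator $A_p$: $\tau_p f=-(pf')'$. The maximal operator $(A_p,\mathcal{D}(A_p))$ is given by $\mathcal{D}(A_p)=\{f\in L^2(\mathbb{R}): f,\,pf'\in AC_{loc}(\mathbb{R}),\ \tau_p f\in L^2(\mathbb{R})\}$ and $A_pf=\tau_pf$ for $f\in\mathcal{D}(A_p)$, where $AC_{loc}(\mathbb{R})$ is the space of locally absolutely continuous functions on $\mathbb{R}$ (the condition $pf'\in AC_{loc}$ means that $pf'$ agrees almost everywhere with such a function). For $p\in PC_N$ this operator is self-adjoint (and nonnegative) on $L^2(\mathbb{R})$; it is called the self-adjoint realization of $\tau_p$. Paley--Wiener space of variable bandwidth: for a Borel set $\Lambda\subset[0,\infty)$, $\chi_\Lambda(A_p)$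 denotes the spectral projection of $A_p$ associated with $\Lambda$. For $\Omega>0$, $$PW_\Omega(A_p)=\chi_{[0,\Omega^2]}(A_p)(L^2(\mathbb{R}))=\{f\in L^2(\mathbb{R}): f=\chi_{[0,\Omega^2]}(A_p)f\}.$$ Elements of $PW_\Omega(A_p)$ are identified with their continuous representatives. *)

(* Defs.v *)
From HB Require Import structures.
From mathcomp Require Import all_boot all_order all_algebra.
From mathcomp Require Import complex.
From mathcomp Require Import all_classical all_reals all_analysis.

Set Implicit Arguments.
Unset Strict Implicit.
Unset Printing Implicit Defensive.

Import Order.TTheory GRing.Theory Num.Theory.
Import numFieldNormedType.Exports.

Local Open Scope classical_set_scope.
Local Open Scope ring_scope.
Local Open Scope complex_scope.

(* The convention x_0 = -oo, x_(N+1) = +oo is kept by taking the nodes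
   in \bar R; strict monotonicity forces x_1, ..., x_N to be finite.  The
   values of p at the nodes are left unspecified. *)
Definition PC (R : realType) (N : nat) (p : R -> R) : Prop :=
  exists (x : nat -> \bar R) (c : nat -> R),
    [/\ x 0%N = -oo%E, x N.+1 = +oo%E,
        (forall j, (j <= N)%N -> (x j < x j.+1)%E),
        (forall j, (j <= N)%N -> 0 < c j) &
        (forall j t, (j <= N)%N -> (x j < t%:E)%E -> (t%:E < x j.+1)%E ->
           p t = c j)].

Section L2.
Context {R : realType}.
Implicit Types (f g : R -> R[i]).

Definition aeq f g : Prop :=
  {ae (@lebesgue_measure R), forall x, f x = g x}.

Definition measurable_complex f : Prop :=
  measurable_fun [set: R] (fun x => complex.Re (f x)) /\
  measurable_fun [set: R] (fun x => complex.Im (f x)).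

Definition sqnorm f : \bar R :=
  (\int[@lebesgue_measure R]_x ((Normc.normc (f x)) ^+ 2)%:E)%E.

(* Elements of L^2(R; C) are represented by Borel functions (every class of
   Lebesgue measurable functions contains one); equality in L^2 is [aeq]. *)
Definition L2 f : Prop := measurable_complex f /\ (sqnorm f < +oo)%E.

Definition dotL2 f g : R[i] :=
  (\int[@lebesgue_measure R]_x complex.Re (f x * (g x)^*))%R +i*
  (\int[@lebesgue_measure R]_x complex.Im (f x * (g x)^*))%R.

End L2.

Section SturmLiouville.
Context {R : realType}.
Implicit Types (f g u h : R -> R[i]) (p : R -> R).

Definition abs_cont (a b : R) f : Prop :=
  forall e : R, 0 < e -> exists2 d : R, 0 < d &
    forall (n : nat) (s t : 'I_n -> R),
      (forall i, [/\ a <= s i, s i <= t i & t i <= b]) ->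
      (forall i j, i != j -> t i <= s j \/ t j <= s i) ->
      \sum_(i < n) (t i - s i) < d ->
      \sum_(i < n) Normc.normc (f (t i) - f (s i)) < e.

Definition AC_loc f : Prop := forall a b : R, a <= b -> abs_cont a b f.

Definition is_deriveC (x : R) f (v : R[i]) : Prop :=
  is_derive x (1 : R) (fun y => complex.Re (f y) : R) (complex.Re v) /\
  is_derive x (1 : R) (fun y => complex.Im (f y) : R) (complex.Im v).

(* [tau p f u]: f is in AC_loc, p f' agrees a.e. with some h in AC_loc,
   and u = - h' a.e.  Derivatives are required (and, by Lebesgue's theorem,
   exist) almost everywhere. *)
Definition tau p f u : Prop :=
  AC_loc f /\ exists2 h, AC_loc h &
    {ae (@lebesgue_measure R), forall x,
      exists2 v, is_deriveC x f v & h x = (p x)%:C * v} /\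
    {ae (@lebesgue_measure R), forall x, is_deriveC x h (- u x)}.

(* Graph of the maximal operator A_p: f is in the domain and A_p f = u. *)
Definition SLop p f u : Prop :=
  [/\ L2 f, L2 u & exists2 f0, aeq f f0 & tau p f0 u].

End SturmLiouville.

Section Spectral.
Context {R : realType}.
Implicit Types (f g u : R -> R[i]) (B : set R).

Definition set_op := set R -> (R -> R[i]) -> (R -> R[i]).

Implicit Types E : set_op.

(* Each E B is an operator on L^2, given on representatives. *)
Definition orth_proj (P : (R -> R[i]) -> (R -> R[i])) : Prop :=
  [/\ (forall f, L2 f -> L2 (P f)),
      (forall f g, L2 f -> L2 g -> aeq f g -> aeq (P f) (P g)),
      (forall (a : R[i]) f g, L2 f -> L2 g ->
         aeq (P (fun x => a * f x + g x)) (fun x => a * P f x + P g x)),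
      (forall f, L2 f -> aeq (P (P f)) (P f)) &
      (forall f g, L2 f -> L2 g -> dotL2 (P f) g = dotL2 f (P g))].

Definition projection_valued_measure E : Prop :=
  [/\ (forall B, measurable B -> orth_proj (E B)),
      (forall f, L2 f -> aeq (E set0 f) (fun=> 0)),
      (forall f, L2 f -> aeq (E setT f) f),
      (forall B C f, measurable B -> measurable C -> L2 f ->
         aeq (E (B `&` C) f) (E B (E C f))) &
      (forall (F : nat -> set R) f,
         (forall n, measurable (F n)) -> trivIset setT F -> L2 f ->
         (fun n => sqnorm (fun x =>
            \sum_(i < n) E (F i) f x - E (\bigcup_i F i) f x))
           @ \oo --> 0%E)].

(* mu is the measure B |-> <E B f, f>; it is determined on measurable sets. *)
Definition scalar_measure E f (mu : {measure set R -> \bar R}) : Prop :=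
  forall B, measurable B -> mu B = (complex.Re (dotL2 (E B f) f))%:E.

(* A = \int lambda dE(lambda), for an operator A given by its graph: f is in
   the domain of A iff \int lambda^2 d<E f, f> < +oo, and then
   <A f, f> = \int lambda d<E f, f>. *)
Definition spectral_measure_of (A : (R -> R[i]) -> (R -> R[i]) -> Prop) E :
    Prop :=
  projection_valued_measure E /\
  forall f, L2 f -> exists2 mu : {measure set R -> \bar R},
    scalar_measure E f mu &
    ((exists u, A f u) <-> (\int[mu]_l (l ^+ 2)%:E < +oo)%E) /\
     (forall u, A f u -> dotL2 u f = (\int[mu]_l l)%R%:C).

(* PW_Omega(A_p): chi_Lambda(A_p) is E Lambda for the spectral measure E of
   A_p, which exists and is unique by the spectral theorem.  Continuity
   selects the continuous representative. *)
Definition PW (Omega : R) (p : R -> R) f : Prop :=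
  [/\ continuous (fun x => complex.Re (f x) : R),
      continuous (fun x => complex.Im (f x) : R),
      L2 f &
      exists2 E, spectral_measure_of (SLop p) E &
        aeq f (E `[0, Omega ^+ 2]%classic f)].

End Spectral.

(* Main.v *)
Require Import Defs.
From mathcomp Require Import all_boot all_order all_algebra.
From mathcomp Require Import complex.
From mathcomp Require Import all_classical all_reals all_analysis measurable_realfun.
From mathcomp Require Import ring lra.

(** The proof needs no analyticity and no uniqueness of the spectral measure.
    Applying A repeatedly to f in PW_Omega gives u_0 = f, u_(k+1) = A u_k with
    |u_k| <= Omega^(2k) |f| in L^2, and such sequences are closed under addition.
    A sum s_k of two of them, started at a real f + g, has unique continuation:
    if all s_k and all p s_k' vanish at a point t, integrating twice from t
    bounds sup |s_k| on [t - d, t + d] by d^2 / c times sup |s_(k+1)|, where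
    c > 0 is a lower bound of p, while the L^2 bounds give
    sup |s_k| <= K Omega^(2k).  For small d, independent of t, all s_k vanish on
    [t - d, t + d], hence everywhere.  Finally, if f(t) <> g(t) then
    f^2 = g^2 makes f + g vanish near t, hence on R. *)

Set Implicit Arguments.
Unset Strict Implicit.
Unset Printing Implicit Defensive.

Import Order.TTheory GRing.Theory Num.Theory.
Import numFieldNormedType.Exports.

Local Open Scope classical_set_scope.
Local Open Scope ring_scope.

(** * Real induction and absolute continuity of real-valued functions *)

(** The supremum s of the points where [P] holds is passed by the step at s. The step leads from a
    point on the left of s to one on its right, which spares a separate limit argument for [P s]. *)
Lemma real_induction (R : realType) (a b : R) (P : R -> Prop) :
  a <= b -> P a ->
  (forall s, a <= s <= b -> exists2 d, 0 < d & forall x z,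
     a <= x -> x <= s -> s <= z -> z <= b -> s - d < x -> z < s + d ->
     P x -> P z) ->
  P b.
Proof.
move=> ab Pa step.
pose S := [set x | a <= x <= b /\ P x].
have Sa : S a by split=> //; rewrite lexx ab.
have supS : has_sup S.
  by split; [exists a|exists b => x [/andP[]]].
have as_ : a <= sup S by apply: ub_le_sup => //; case: supS.
have sb : sup S <= b by apply: ge_sup; [exists a|move=> x [/andP[]]].
have [d d0 dP] : exists2 d, 0 < d & forall x z,
     a <= x -> x <= sup S -> sup S <= z -> z <= b -> sup S - d < x ->
     z < sup S + d -> P x -> P z by apply: step; rewrite as_ sb.
have [x [/andP[ax xb] Px] sx] := sup_adherent d0 supS.
have xs : x <= sup S by apply: ub_le_sup; [case: supS|split=> //; rewrite ax].
(* If this point were not [b], it would exceed the supremum; half of [d] keeps it within reach of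
   the step. *)
pose z := Num.min b (sup S + d / 2).
have sz : sup S <= z by rewrite le_min sb/= lerDl divr_ge0 // ltW.
have zb : z <= b by rewrite ge_min lexx.
have Pz : P z.
  apply: (dP x) => //; rewrite /z gt_min; apply/orP; right; lra.
have : z <= sup S.
  by apply: ub_le_sup; [case: supS|split=> //; rewrite zb (le_trans as_)].
rewrite /z ge_min => /orP[bs|]; last by lra.
have E : z = b by apply/eqP; rewrite eq_le zb (le_trans bs).
by rewrite -E.
Qed.

(** Comparing increments needs an order, so absolute continuity is restated for real-valued
    functions. *)
Definition real_AC (R : realType) (a b : R) (F : R -> R) : Prop :=
  forall e : R, 0 < e -> exists2 d : R, 0 < d &
    forall (n : nat) (s t : 'I_n -> R),
      (forall i, [/\ a <= s i, s i <= t i & t i <= b]) ->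
      (forall i j, i != j -> t i <= s j \/ t j <= s i) ->
      \sum_(i < n) (t i - s i) < d ->
      \sum_(i < n) `|F (t i) - F (s i)| < e.

(** The covering argument below adds its intervals one at a time, so indexed families are replaced
    by lists. The newest and rightmost interval is the head, whence the orientation of the pairwise
    condition. *)
Lemma real_AC_seq (R : realType) (a b e d : R) (F : R -> R) (ps : seq (R * R)) :
  (forall (n : nat) (s t : 'I_n -> R),
      (forall i, [/\ a <= s i, s i <= t i & t i <= b]) ->
      (forall i j, i != j -> t i <= s j \/ t j <= s i) ->
      \sum_(i < n) (t i - s i) < d ->
      \sum_(i < n) `|F (t i) - F (s i)| < e) ->
  all (fun q => [&& a <= q.1, q.1 <= q.2 & q.2 <= b]) ps ->
  pairwise (fun q r => r.2 <= q.1) ps ->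
  \sum_(q <- ps) (q.2 - q.1) < d ->
  \sum_(q <- ps) `|F q.2 - F q.1| < e.
Proof.
move=> H /allP psab /(pairwiseP (0, 0)) dis.
rewrite !(big_nth (0, 0)) !big_mkord => sd.
apply: H sd => [i|i j ij].
  by have /psab/and3P[] := mem_nth (0, 0) (ltn_ord i).
have [ltij|ltji|/val_inj eij] := ltngtP i j.
- by right; apply: dis; rewrite ?inE.
- by left; apply: dis; rewrite ?inE.
- by rewrite eij eqxx in ij.
Qed.

(** * Comparison of increments through derivatives that exist almost everywhere *)

Section mean_value.
Context {R : realType}.
Notation mu := (@lebesgue_measure R).

Lemma is_derive_straddle (F : R -> R) (s v e : R) : is_derive s 1 F v -> 0 < e ->
  exists2 d, 0 < d & forall y, `|y - s| < d ->
    `|F y - F s - v * (y - s)| <= e * `|y - s|.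
Proof.
move=> Fv e0; have := @ex_derive _ _ _ _ _ _ _ Fv.
have := @derive_val _ _ _ _ _ _ _ Fv; rewrite /derive /derivable => E cv.
have : (fun h => h^-1 *: (F (h *: 1 + s) - F s)) @ 0^' --> v by rewrite -E.
move=> /cvgrPdist_le /(_ e e0) /nbhs_ballP[d /= d0 dP].
exists d => // y ysd.
have [->|ys] := eqVneq y s; first by rewrite !subrr mulr0 subrr !normr0 mulr0.
have /dP : ball 0 d (y - s) by rewrite -ball_normE /= sub0r normrN.
have ys0 : y - s != 0 by rewrite subr_eq0.
move=> /(_ ys0) /=; rewrite (_ : (y - s) *: 1 + s = y); last first.
  by rewrite /GRing.scale /= mulr1 subrK.
move=> H.
have := ler_wpM2r (normr_ge0 (y - s)) H; rewrite -normrM mulrBl.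
rewrite distrC; congr (`| _ | <= _).
by rewrite /GRing.scale /= mulrAC mulVf // mul1r.
Qed.

(* A Cousin-type argument: away from the exceptional null set the increments
   are compared through the derivatives; the exceptional points are covered by
   intervals of small total length, on which absolute continuity makes the
   increments of [F] negligible, those of [G] being nonnegative. *)
Lemma AC_increment_le (F G : R -> R) (a b : R) : a <= b -> real_AC a b F ->
  (forall x y, a <= x -> x <= y -> y <= b -> G x <= G y) ->
  {ae mu, forall x, a <= x <= b -> exists v w : R,
     [/\ is_derive x 1 F v, is_derive x 1 G w & v <= w]} ->
  F b - F a <= G b - G a.
Proof.
move=> ab acF ndG [A [mA A0 Asub]].
apply/ler_addgt0Pr => e e0.
(* Half of [e] pays for the differentiation errors, at most [e1 * (b - a)] in all, the other half
   for the exceptional intervals; the [+ 1] covers [a = b]. *)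
pose e1 := e / 2 / (b - a + 1).
have ba1 : 0 < b - a + 1 by lra.
have e10 : 0 < e1 by rewrite !divr_gt0.
have e20 : 0 < e / 2 by rewrite divr_gt0.
have [d d0 dP] := acF _ e20.
have Afin : (mu A < +oo)%E by rewrite A0 ltry.
have [U [oU AU UA]] := lebesgue_regularity_outer mA Afin d0.
have mU : measurable U by exact: measurable_realfun.open_measurable.
have Ud : (mu U < d%:E)%E.
  apply: le_lt_trans UA; rewrite -[leRHS]add0e -A0 -measureU //.
  - by rewrite setDUK.
  - exact: measurableD.
  - by rewrite setDIK.
(* The measure of [U] up to [x] is the budget of length for the exceptional intervals chosen so far;
   it always stays below [d]. *)
pose m x := fine (mu (U `&` `]a, x])).
have mUx x : measurable (U `&` `]a, x]) by apply: measurableI.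
have Ufin x : mu (U `&` `]a, x]) \is a fin_num.
  rewrite ge0_fin_numE //; apply: le_lt_trans (lt_trans Ud (ltry _)).
  by apply: le_measure; rewrite ?inE //; exact: mUx.
have md x : m x < d.
  rewrite -lte_fin fineK //; apply: le_lt_trans Ud.
  by apply: le_measure; rewrite ?inE //; exact: mUx.
have m_nd x z : x <= z -> m x <= m z.
  move=> xz; apply: fine_le => //; apply: le_measure; rewrite ?inE //; try exact: mUx.
  apply: setIS; apply: subset_itvl; by rewrite bnd_simp.
have m_add x z : a <= x -> x <= z -> `]x, z] `<=` U -> m x + (z - x) <= m z.
  move=> ax xz xzU; rewrite -lee_fin EFinD !fineK //.
  have -> : ((z - x)%:E = mu `]x, z])%E.
    rewrite lebesgue_measure_itv /= lte_fin; case: ltgtP xz => // ->.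
    by rewrite subrr.
  rewrite -measureU //; [|exact: mUx|]; last first.
    apply/seteqP; split=> y //= [[_ +]].
    rewrite !in_itv /= => /andP[_ yx] /andP[xy _].
    by move: (lt_le_trans xy yx); rewrite ltxx.
  apply: le_measure; rewrite ?inE //; try exact: mUx; first exact: (measurableU _ _ (mUx _)).
  move=> y [[Uy]|/= yxz]; rewrite /= ?in_itv /=; [move=> /andP[ay yx]|].
    by split=> //; rewrite ay (le_trans yx).
  split; first exact: xzU.
  by move: yxz; rewrite in_itv /= => /andP[xy ->]; rewrite (le_lt_trans ax).
(* Invariant of the real induction: the list collects intervals around exceptional points, and the
   increments of [F] over them are the only ones not controlled by [G] and the error term. *)
pose Q x := exists ps : seq (R * R),
  [/\ all (fun q => [&& a <= q.1, q.1 <= q.2 & q.2 <= x]) ps,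
      pairwise (fun q r => r.2 <= q.1) ps,
      \sum_(q <- ps) (q.2 - q.1) <= m x &
      F x - F a <= G x - G a + e1 * (x - a) + \sum_(q <- ps) `|F q.2 - F q.1|].
have : Q b.
  apply: (real_induction ab).
    exists [::]; split=> //; rewrite ?big_nil ?fine_ge0 //.
    by rewrite !subrr mulr0 !addr0.
  move=> s /andP[as_ sb].
  have [/AU Us|nAs] := pselect (A s).
    have /nbhs_ballP[r /= r0 rU] : nbhs s U by exact: open_nbhs_nbhs.
    exists r => // x z ax xs sz zb xr zr [ps [psx psd psm psF]].
    have xz : x <= z by exact: le_trans sz.
    exists ((x, z) :: ps); split => /=.
    - rewrite ax xz lexx /=; apply: sub_all psx => q /and3P[-> -> /= qx].
      exact: le_trans xz.
    - rewrite psd andbT; apply: sub_all psx => q /and3P[_ _ qx] //.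
    - rewrite big_cons /= addrC; apply: le_trans (m_add x z ax xz _).
        by rewrite lerD2r.
      move=> y /=; rewrite in_itv /= => /andP[xy yz]; apply: rU.
      by rewrite -ball_normE /= ltr_norml; apply/andP; split; lra.
    - rewrite big_cons /=.
      have := ndG _ _ ax xz zb.
      have := ler_norm (F z - F x).
      have : e1 * (x - a) <= e1 * (z - a) by rewrite ler_pM2l // lerD2r.
      by move: psF; lra.
  have [v [w [Fv Gw vw]]] : exists v w : R,
     [/\ is_derive s 1 F v, is_derive s 1 G w & v <= w].
    by apply: contra_notP nAs => H; apply: Asub => /= /(_ _)/H; apply; rewrite as_.
  have e120 : 0 < e1 / 2 by rewrite divr_gt0.
  have [d1 d10 d1P] := is_derive_straddle Fv e120.
  have [d2 d20 d2P] := is_derive_straddle Gw e120.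
  exists (Num.min d1 d2); first by rewrite lt_min d10.
  move=> x z ax xs sz zb xr zr [ps [psx psd psm psF]].
  have xz : x <= z by exact: le_trans sz.
  have near_ y : x <= y -> y <= z ->
      `|y - s| < d1 /\ `|y - s| < d2.
    move=> xy yz; apply/andP; rewrite -lt_min ltr_norml.
    by apply/andP; split; lra.
  have [/d1P xF /d2P xG] := near_ x (lexx _) xz.
  have [/d1P zF /d2P zG] := near_ z xz (lexx _).
  exists ps; split=> //.
  - by apply: sub_all psx => q /and3P[-> -> /= qx]; exact: le_trans xz.
  - exact: le_trans (m_nd _ _ xz).
  (* At a regular point, straddling [s] costs [e1 / 2] times the length for [F] and as much again
     for [G]. *)
  - move: xF xG zF zG; rewrite !(ler0_norm (_ : x - s <= 0)) ?subr_le0 //.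
    rewrite !(ger0_norm (_ : 0 <= z - s)) ?subr_ge0 //.
    rewrite !ler_norml => /andP[xF1 xF2] /andP[xG1 xG2] /andP[zF1 zF2] /andP[zG1 zG2].
    have h1 : v * (z - s) <= w * (z - s) by rewrite ler_wpM2r // subr_ge0.
    have h2 : v * (s - x) <= w * (s - x) by rewrite ler_wpM2r // subr_ge0.
    move: psF h1 h2 xF1 xF2 xG1 xG2 zF1 zF2 zG1 zG2.
    rewrite -[e1 / 2]/(e1 * 2^-1) !mulrBr !mulrN.
    set S := \sum_(_ <- _) _.
    lra.
move=> [ps [psx psd psm psF]].
have Sps := real_AC_seq dP psx psd (le_lt_trans psm (md b)).
apply: (le_trans psF).
have : e1 * (b - a) <= e / 2.
  rewrite /e1 -[leRHS]mulr1 -mulrA ler_pM2l // mulrC ler_pdivrMr // mul1r; lra.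
by move: Sps; lra.
Qed.

End mean_value.

(** * Lipschitz and L2 bounds for increments, and vanishing almost everywhere *)

Section mean_value_corollaries.
Context {R : realType}.
Notation mu := (@lebesgue_measure R).
Implicit Types (F G : R -> R).

Lemma aeS (P Q : R -> Prop) : (forall x, P x -> Q x) ->
  {ae mu, forall x, P x} -> {ae mu, forall x, Q x}.
Proof. by move=> PQ; apply: filterS; first exact: (ae_filter_ringOfSetsType mu). Qed.

Lemma aeS2 (P Q S : R -> Prop) : (forall x, P x -> Q x -> S x) ->
  {ae mu, forall x, P x} -> {ae mu, forall x, Q x} -> {ae mu, forall x, S x}.
Proof. by move=> PQ; apply: filterS2; first exact: (ae_filter_ringOfSetsType mu). Qed.

Lemma is_derive_mull (K y v : R) F : is_derive y 1 F v ->
  is_derive y 1 (fun z => K * F z) (K * v).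
Proof. exact: is_deriveZ. Qed.

Lemma is_derive_mull_id (K y : R) : is_derive y 1 (fun z => K * z) K.
Proof. by have := is_derive_mull K (is_derive_id y 1); rewrite mulr1. Qed.

Lemma real_ACN (a b : R) F : real_AC a b F -> real_AC a b (- F).
Proof.
move=> acF e e0; have [d d0 dP] := acF e e0; exists d => // n s t st dis sd.
have := dP n s t st dis sd; congr (_ < _); apply: eq_bigr => i _.
by rewrite !fctE -opprD normrN.
Qed.

Lemma real_AC_continuous F : (forall a b, a <= b -> real_AC a b F) -> continuous F.
Proof.
move=> acF x; apply/cvgrPdist_lt => e e0.
have [|d d0 dP] := acF (x - 1) (x + 1) _ e e0; first by lra.
have d10 : 0 < Num.min d 1 by rewrite lt_min d0 ltr01.
apply/nbhs_ballP; exists (Num.min d 1) => //= y.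
rewrite /ball /= lt_min => /andP[xyd xy1].
have {xy1} [xy1 xy2] : x - 1 <= y /\ y <= x + 1.
  by move: xy1; rewrite ltr_norml => /andP[]; lra.
have := dP 1%N (fun=> Num.min x y) (fun=> Num.max x y); rewrite !big_ord1.
have [xy|yx] := leP x y => H.
- rewrite distrC; apply: H => [i|i j|].
  + by split; lra.
  + by rewrite !ord1 eqxx.
  + by rewrite -[ltLHS]ger0_norm ?subr_ge0 // distrC.
- apply: H => [i|i j|].
  + by split; lra.
  + by rewrite !ord1 eqxx.
  + by rewrite -[ltLHS]ger0_norm ?subr_ge0 // ltW.
Qed.

Lemma AC_norm_increment_le F G (a b : R) : a <= b -> real_AC a b F ->
  (forall x y, a <= x -> x <= y -> y <= b -> G x <= G y) ->
  {ae mu, forall x, a <= x <= b -> exists v w : R,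
     [/\ is_derive x 1 F v, is_derive x 1 G w & `|v| <= w]} ->
  `|F b - F a| <= G b - G a.
Proof.
move=> ab acF ndG ae; rewrite ler_norml; apply/andP; split; last first.
  apply: AC_increment_le => //; apply: aeS ae => x + xab.
  move=> /(_ xab) [v [w [Fv Gw vw]]]; exists v, w; split=> //.
  by apply: le_trans vw; exact: ler_norm.
rewrite lerNl opprB.
suff : (- F) b - (- F) a <= G b - G a by rewrite !fctE; lra.
apply: AC_increment_le => //; first exact: real_ACN.
apply: aeS ae => x + xab.
move=> /(_ xab) [v [w [Fv Gw vw]]]; exists (- v), w; split=> //.
  exact: is_deriveN.
by apply: le_trans vw; rewrite -normrN; exact: ler_norm.
Qed.

Lemma AC_norm_increment_le_ball F G (t r : R) :
  (forall a b, a <= b -> real_AC a b F) ->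
  (forall x y, x <= y -> G x <= G y) ->
  {ae mu, forall x, `|x - t| <= r -> exists v w : R,
     [/\ is_derive x 1 F v, is_derive x 1 G w & `|v| <= w]} ->
  forall x, `|x - t| <= r -> `|F x - F t| <= `|G x - G t|.
Proof.
move=> acF ndG ae x; rewrite ler_norml => /andP[xt1 xt2].
have [tx|xt] := leP t x.
- apply: le_trans (ler_norm _).
  apply: AC_norm_increment_le => //; first exact: acF.
    by move=> ? ? _ /ndG.
  apply: aeS ae => y + /andP[ty yx]; apply.
  by rewrite ler_norml; apply/andP; split; lra.
- rewrite distrC [leRHS]distrC; apply: le_trans (ler_norm _).
  apply: AC_norm_increment_le => //; first exact: ltW.
    by apply: acF; exact: ltW.
    by move=> ? ? _ /ndG.
  apply: aeS ae => y + /andP[ty yx]; apply.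
  by rewrite ler_norml; apply/andP; split; lra.
Qed.

Lemma AC_norm_increment_le_lip F (t r K : R) : 0 <= K ->
  (forall a b, a <= b -> real_AC a b F) ->
  {ae mu, forall x, `|x - t| <= r -> exists2 v : R, is_derive x 1 F v & `|v| <= K} ->
  forall x, `|x - t| <= r -> `|F x - F t| <= K * r.
Proof.
move=> K0 acF ae x xtr.
apply: (@le_trans _ _ `|K * x - K * t|); last first.
  by rewrite -mulrBr normrM ger0_norm // ler_wpM2l.
apply: (@AC_norm_increment_le_ball F (fun y => K * y) t r) => //.
  by move=> y z yz; rewrite ler_wpM2l.
apply: aeS ae => y + yr => /(_ yr)[v Fv vK]; exists v, K; split=> //.
exact: is_derive_mull_id.
Qed.

(** Around a point of the ball where [F] is nonzero, continuity gives a smaller ball of positive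
    measure inside the exceptional null set. *)
Lemma ae_eq0_ball F (t r : R) : continuous F ->
  {ae mu, forall x, `|x - t| < r -> F x = 0} ->
  forall x, `|x - t| < r -> F x = 0.
Proof.
move=> cF [A [mA A0 sA]] x xr; apply/eqP/negP => /negP Fx.
have /nbhs_ballP[e /= e0 eP] : \forall y \near x, F y != 0 /\ `|y - t| < r.
  near=> y; split.
  - near: y; have := cF x; move/cvgrPdist_lt/(_ `|F x|).
    rewrite normr_gt0 => /(_ Fx); apply: filterS => y.
    by apply: contraTneq => ->; rewrite subr0 ltxx.
  - near: y; have e0 : 0 < r - `|x - t| by rewrite subr_gt0.
    apply/nbhs_ballP; exists (r - `|x - t|) => //= y; rewrite -ball_normE /=.
    move=> xy; have := ler_normD (y - x) (x - t).
    by rewrite addrA subrK (distrC y x); lra.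
have sub : ball x e `<=` A.
  move=> y /eP[Fy yr]; apply: sA => /= /(_ yr) E.
  by rewrite E eqxx in Fy.
have : (mu (ball x e) <= mu A)%E.
  apply: le_measure; rewrite ?inE //.
  by apply: measurable_realfun.open_measurable; exact: ball_open.
rewrite A0 (lebesgue_measure_ball x (ltW e0)).
rewrite leNgt => /negP; apply.
by rewrite lte_fin mulrn_wgt0.
Unshelve. all: by end_near. Qed.

Lemma Rintegral_subset (A B : set R) F : measurable A -> measurable B ->
  A `<=` B -> mu.-integrable B (EFin \o F) -> (forall x, 0 <= F x) ->
  \int[mu]_(x in A) F x <= \int[mu]_(x in B) F x.
Proof.
move=> mA mB AB iF F0; apply: fine_le.
- by apply: integrable_fin_num => //; exact: integrableS iF.
- exact: integrable_fin_num.
- apply: ge0_subset_integral => //; first by case/integrableP: iF.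
  by move=> x _; rewrite lee_fin.
Qed.

(* Comparing F with s x / 2 + (\int_(-oo)^x g^2) / (2 s) replaces the
   Cauchy-Schwarz inequality by [|g| <= (s + g^2 / s) / 2]. *)
Lemma AC_norm_increment_le_L2 F (g : R -> R) (t s C : R) : 0 < s ->
  (forall a b, a <= b -> real_AC a b F) ->
  mu.-integrable setT (EFin \o (fun x => g x ^+ 2)) ->
  \int[mu]_x (g x ^+ 2) <= C ->
  {ae mu, forall x : R, is_derive x (1 : R) F (- g x)} ->
  forall x, `|x - t| <= 1 -> `|F x - F t| <= 2^-1 * (s + s^-1 * C).
Proof.
move=> s0 acF ig gC Fg x xt1.
pose H y := \int[mu]_(z in `]-oo, y]) (g z ^+ 2).
have H_nd y z : y <= z -> H y <= H z.
  move=> yz; apply: Rintegral_subset => //.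
  - by apply: subset_itvl; rewrite bnd_simp.
  - exact: integrableS ig.
  - by move=> w; rewrite sqr_ge0.
have H_ge0 y : 0 <= H y by apply: Rintegral_ge0 => w _; rewrite sqr_ge0.
have H_le y : H y <= C.
  apply: le_trans gC; apply: Rintegral_subset => // w; exact: sqr_ge0.
have H_der : {ae mu, forall y : R, is_derive y (1 : R) H (g y ^+ 2)}.
  have lg : locally_integrable setT (fun x => g x ^+ 2).
    by apply: open_integrable_locally => //; exact: openT.
  have := @FTC1Ny R (fun x => g x ^+ 2) _ lg.
  move=> /(_ (fun y => integrableS measurableT _ _ ig)) D.
  apply: aeS (D _ _) => // y [dH E]; apply: DeriveDef => //.
  by rewrite -derive1E E.
have s10 : 0 < s^-1 by rewrite invr_gt0.
pose G y := 2^-1 * (s * y + s^-1 * H y).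
have half0 : (0 : R) < 2^-1 by rewrite invr_gt0.
apply: (@le_trans _ _ `|G x - G t|).
  apply: (@AC_norm_increment_le_ball F G t 1) => //.
    move=> y z yz; rewrite ler_wpM2l ?(ltW half0) // lerD //.
      by rewrite ler_wpM2l // ltW.
    by rewrite ler_wpM2l ?H_nd // ltW.
  apply: aeS2 Fg H_der => y Fy Hy _.
  exists (- g y), (2^-1 * (s + s^-1 * g y ^+ 2)); split=> //.
    apply: is_derive_mull.
    exact: (is_deriveD (is_derive_mull_id s y) (is_derive_mull s^-1 Hy)).
  rewrite normrN ler_pdivlMl // -(ler_pM2l s0) mulrDr.
  rewrite [s * (s^-1 * _)]mulrA divff ?gt_eqF // mul1r.
  rewrite -(real_normK (num_real (g y))).
  by have := sqr_ge0 (s - `|g y|); lra.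
(* Up to the factor one half, the linear part contributes at most [s] because [|x - t| <= 1], and
   the other part at most [s^-1 * C] because [H] takes values between 0 and [C]. *)
rewrite /G -mulrBr normrM (ger0_norm (ltW half0)) ler_wpM2l ?(ltW half0) //.
have -> : s * x + s^-1 * H x - (s * t + s^-1 * H t) =
          s * (x - t) + s^-1 * (H x - H t) by lra.
apply: (le_trans (ler_normD _ _)); rewrite !normrM (ger0_norm (ltW s0)).
rewrite (ger0_norm (ltW s10)) lerD //.
  by rewrite -[leRHS]mulr1 ler_wpM2l // ltW.
rewrite ler_wpM2l ?(ltW s10) // ler_norml.
have := H_ge0 x; have := H_ge0 t; have := H_le x; have := H_le t.
by move=> *; apply/andP; split; lra.
Qed.

End mean_value_corollaries.

(** * Unique continuation along a chain *)

Section unique_continuation.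
Context {R : realType}.
Notation mu := (@lebesgue_measure R).

(** What a sequence u_(k+1) = A u_k yields in real parts: [phi k] stands for u_k and [eta k] for its
    quasi-derivative p u_k'. Later [m] is Omega^2 and [C] bounds the squared norm of u_0. *)
Definition L2_chain (p : R -> R) (C m : R) (phi eta : nat -> R -> R) : Prop :=
  forall k,
  [/\ (forall a b, a <= b -> real_AC a b (phi k)),
      (forall a b, a <= b -> real_AC a b (eta k)),
      {ae mu, forall x : R,
        exists2 v : R, is_derive x (1 : R) (phi k) v & eta k x = p x * v},
      {ae mu, forall x : R, is_derive x (1 : R) (eta k) (- phi k.+1 x)} &
      mu.-integrable setT (EFin \o (fun x => phi k x ^+ 2)) /\
      \int[mu]_x (phi k x ^+ 2) <= C * (m ^+ k) ^+ 2].

Variables (p : R -> R) (c C m : R) (phi eta : nat -> R -> R).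
Hypotheses (c0 : 0 < c) (pc : {ae mu, forall x, c <= p x}) (m0 : 0 < m)
  (chain : L2_chain p C m phi eta).

Let ac_phi k : forall a b, a <= b -> real_AC a b (phi k).
Proof. by have [] := chain k. Qed.

Let ac_eta k : forall a b, a <= b -> real_AC a b (eta k).
Proof. by have [] := chain k. Qed.

Let C_ge0 : 0 <= C.
Proof.
have [_ _ _ _ [_]] := chain 0; rewrite expr0 expr1n mulr1; apply: le_trans.
by apply: Rintegral_ge0 => x _; rewrite sqr_ge0.
Qed.

(** Almost everywhere the derivative of [phi k] is [eta k / p], and [p >= c] makes [c^-1 * K] a
    Lipschitz constant. *)
Let phi_increment_le k (t r K : R) : 0 <= K -> phi k t = 0 ->
  (forall x, `|x - t| <= r -> `|eta k x| <= K) ->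
  forall x, `|x - t| <= r -> `|phi k x| <= c^-1 * K * r.
Proof.
move=> K0 phit etaK x xr; rewrite -[phi k x]subr0 -phit.
apply: AC_norm_increment_le_lip (ac_phi k) _ _ xr.
  by rewrite mulr_ge0 // invr_ge0 ltW.
have [_ _ D _ _] := chain k; apply: aeS2 D pc => y [v Dv E] cp yr.
exists v => //; have := etaK _ yr; rewrite E normrM ler_pdivlMl //.
by apply: le_trans; rewrite ler_wpM2r // (le_trans cp) // ler_norm.
Qed.

Let eta_increment_le k (t r K : R) : 0 <= K -> eta k t = 0 ->
  (forall x, `|x - t| <= r -> `|phi k.+1 x| <= K) ->
  forall x, `|x - t| <= r -> `|eta k x| <= K * r.
Proof.
move=> K0 etat phiK x xr; rewrite -[eta k x]subr0 -etat.
apply: AC_norm_increment_le_lip (ac_eta k) _ _ xr => //.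
have [_ _ _ D _] := chain k; apply: aeS D => y Dy yr.
by exists (- phi k.+1 y) => //; rewrite normrN phiK.
Qed.

(** With d this size, d^2 m / c is at most 1/2, so that two integrations contract even against the
    growth factor [m]; d is at most 1 as the L2 bound on increments demands. *)
Definition step_size := Num.min 1 (c / (2 * m)).

Lemma step_size_gt0 : 0 < step_size.
Proof. by rewrite lt_min ltr01 divr_gt0 // mulr_gt0. Qed.

Let step_le1 : step_size <= 1.
Proof. by rewrite ge_min lexx. Qed.

Let step_le : c^-1 * m * step_size * step_size <= 2^-1.
Proof.
have d0 := step_size_gt0.
apply: (@le_trans _ _ (c^-1 * m * step_size)).
  by rewrite ler_piMr // !mulr_ge0 // ?invr_ge0 ltW.
have : step_size <= c / (2 * m) by rewrite ge_min lexx orbT.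
rewrite -(@ler_pM2l _ (c^-1 * m)) ?mulr_gt0 ?invr_gt0 //; move/le_trans; apply.
rewrite le_eqVlt; apply/orP; left; apply/eqP; field.
by rewrite !gt_eqF.
Qed.

(** Two integrations from [t] bound [phi k] through [phi k.+1]. Each round halves the a priori bound
    [K * m ^+ k], so iterating forces [phi k] to be 0. *)
Lemma chain_vanish_step (t : R) :
  (forall k, phi k t = 0 /\ eta k t = 0) ->
  forall x, `|x - t| <= step_size -> forall k, phi k x = 0 /\ eta k x = 0.
Proof.
move=> vt; have d0 := step_size_gt0.
(* This is the bound of [AC_norm_increment_le_L2] for [s = m ^+ k.+1], which balances its two terms,
   divided by [m ^+ k]. *)
pose D := 2^-1 * m * (1 + C).
have D0 : 0 <= D by rewrite !mulr_ge0 ?addr_ge0 // ?invr_ge0 // ltW.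
have eta_bd k x : `|x - t| <= step_size -> `|eta k x| <= D * m ^+ k.
  move=> xr; rewrite -[eta k x]subr0 -(vt k).2.
  have [_ _ _ De _] := chain k; have [_ _ _ _ [ig bd]] := chain k.+1.
  have mk0 : 0 < m ^+ k.+1 by rewrite exprn_gt0.
  have := AC_norm_increment_le_L2 mk0 (ac_eta k) ig bd De (le_trans xr step_le1).
  congr (_ <= _); rewrite /D exprS; field.
  by rewrite !gt_eqF // exprn_gt0.
clearbody D.
have [K KE] : exists K, K = c^-1 * D by exists (c^-1 * D).
have K0 : 0 <= K by rewrite KE mulr_ge0 // invr_ge0 ltW.
(* The index [k] is quantified inside the induction on [j], because round [j + 1] at [k] uses round
   [j] at [k + 1]. *)
have phi_bd j : forall k x, `|x - t| <= step_size ->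
    `|phi k x| <= K * m ^+ k * 2^-1 ^+ j.
  elim: j => [|j IH] k x xr.
    rewrite expr0 mulr1.
    apply: (@le_trans _ _ (c^-1 * (D * m ^+ k) * step_size)).
      apply: phi_increment_le xr; rewrite ?(vt k).1 //; last by move=> y /eta_bd.
      by rewrite mulr_ge0 // exprn_ge0 // ltW.
    by rewrite mulrA -KE ler_piMr // mulr_ge0 // exprn_ge0 // ltW.
  have B0 : 0 <= K * m ^+ k.+1 * 2^-1 ^+ j.
    by rewrite !mulr_ge0 // ?exprn_ge0 // ?invr_ge0 // ltW.
  have h := eta_increment_le B0 (vt k).2 (IH k.+1).
  apply: le_trans (phi_increment_le _ (vt k).1 h xr) _.
    by rewrite mulr_ge0 // ltW.
  have -> : c^-1 * (K * m ^+ k.+1 * 2^-1 ^+ j * step_size) * step_size =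
     (K * m ^+ k * 2^-1 ^+ j) * (c^-1 * m * step_size * step_size).
    by rewrite exprS; ring.
  rewrite exprSr [leRHS]mulrA ler_wpM2l //.
  by rewrite !mulr_ge0 // ?exprn_ge0 // ?invr_ge0 // ltW.
have phi0 x k : `|x - t| <= step_size -> phi k x = 0.
  move=> xr; apply/eqP; rewrite -normr_le0; apply/ler_addgt0Pr => e e0.
  rewrite add0r.
  pose B := K * m ^+ k.
  have B0 : 0 <= B by rewrite mulr_ge0 // exprn_ge0 // ltW.
  (* From [B / e < n] and [n < 2 ^ n] the bound after [n] rounds is at most [e]. *)
  pose n := Num.Def.archi_bound (B / e).
  have Bn : B / e < n%:R by apply: archi_boundP; rewrite divr_ge0 // ltW.
  apply: le_trans (phi_bd n k x xr) _.
  rewrite exprVn -/B ler_pdivrMr ?exprn_gt0 // [leRHS]mulrC -ler_pdivrMr // (le_trans (ltW Bn)) //.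
  by rewrite -natrX ler_nat ltnW // ltn_expl.
move=> x xr k; split; first exact: phi0.
apply/eqP; rewrite -normr_le0 -[leRHS](mul0r step_size).
apply: eta_increment_le xr; rewrite ?(vt k).2 // => y yr.
by rewrite phi0 // normr0.
Qed.

Lemma chain_vanish (t : R) : (forall k, phi k t = 0 /\ eta k t = 0) ->
  forall x k, phi k x = 0 /\ eta k x = 0.
Proof.
move=> vt x; have d0 := step_size_gt0.
have H n : forall y, `|y - t| <= n%:R * step_size ->
    forall k, phi k y = 0 /\ eta k y = 0.
  elim: n => [|n IH] y.
    by rewrite mul0r normr_le0 subr_eq0 => /eqP ->.
  (* This point divides the segment from [t] to [y] in the ratio n : 1, so it is within n steps of
     [t] and within one step of [y]. *)
  move=> yn; pose z := t + (y - t) * (n%:R / n.+1%:R).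
  have n10 : (0 : R) < n.+1%:R by rewrite ltr0n.
  have fr : (0 : R) <= n%:R / n.+1%:R by rewrite divr_ge0.
  apply: (@chain_vanish_step z).
    apply: IH; rewrite /z addrAC subrr add0r normrM (ger0_norm fr).
    apply: le_trans (ler_wpM2r fr yn) _; rewrite le_eqVlt; apply/orP; left.
    by apply/eqP; field; rewrite -natr1 in n10; rewrite gt_eqF // addrC.
  have -> : y - z = (y - t) * n.+1%:R^-1.
    by rewrite /z -natr1; field; rewrite -natr1 in n10; rewrite gt_eqF // addrC.
  rewrite normrM (gtr0_norm (_ : 0 < n.+1%:R^-1)) ?invr_gt0 //.
  by rewrite ler_pdivrMr // mulrC.
apply: (H (Num.Def.archi_bound (`|x - t| / step_size))).
by rewrite -ler_pdivrMr // ltW // archi_boundP // divr_ge0 // ltW.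
Qed.

(** Vanishing on an interval propagates along the chain: [phi k] gives [eta k] through p phi', and
    [eta k] gives [phi k.+1] through - eta', first almost everywhere and then everywhere by
    continuity. Hence the whole chain vanishes at [t]. *)
Lemma unique_continuation (t r : R) : 0 < r ->
  (forall x, `|x - t| < r -> phi 0%N x = 0) -> forall x, phi 0%N x = 0.
Proof.
move=> r0 phi0.
have deriv0 (F : R -> R) (v x : R) : (forall x, `|x - t| < r -> F x = 0) -> `|x - t| < r ->
    is_derive x (1 : R) F v -> v = 0.
  move=> F0 xr /@derive_val <-.
  suff -> : 'D_1 F x = 'D_1 (cst (0 : R) : R -> R) x by exact: derive_cst.
  apply: near_eq_derive; have e0 : 0 < r - `|x - t| by rewrite subr_gt0.
  apply/nbhs_ballP; exists (r - `|x - t|) => // y xy; apply: F0.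
  have := ler_normD (y - x) (x - t).
  move: xy; rewrite /ball /= addrA subrK (distrC y x); lra.
have H k : forall x, `|x - t| < r -> phi k x = 0 /\ eta k x = 0.
  elim: k => [|k IH].
    have eta0 : forall x, `|x - t| < r -> eta 0%N x = 0.
      apply: ae_eq0_ball; first exact/real_AC_continuous/ac_eta.
      have [_ _ D _ _] := chain 0; apply: aeS D => x [v Dv ->] xr.
      by rewrite (deriv0 _ _ _ phi0 xr Dv) mulr0.
    by move=> x xr; rewrite phi0 // eta0.
  have phi1 : forall x, `|x - t| < r -> phi k.+1 x = 0.
    apply: ae_eq0_ball; first exact/real_AC_continuous/ac_phi.
    have [_ _ _ D _] := chain k; apply: aeS D => x Dv xr.
    apply/eqP; rewrite -oppr_eq0; apply/eqP; apply: deriv0 xr Dv.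
    by move=> y /IH[].
  have eta1 : forall x, `|x - t| < r -> eta k.+1 x = 0.
    apply: ae_eq0_ball; first exact/real_AC_continuous/ac_eta.
    have [_ _ D _ _] := chain k.+1; apply: aeS D => x [v Dv ->] xr.
    by rewrite (deriv0 _ _ _ phi1 xr Dv) mulr0.
  by move=> x xr; rewrite phi1 // eta1.
have vt k : phi k t = 0 /\ eta k t = 0 by apply: H; rewrite subrr normr0.
by move=> x; have [] := chain_vanish vt x 0%N.
Qed.

End unique_continuation.

(** * The real inner product on L2 *)

Section inner_product.
Context {R : realType}.
Notation mu := (@lebesgue_measure R).
Local Notation Re := complex.Re.
Local Notation Im := complex.Im.
Implicit Types (f g h : R -> R[i]).

(** The real part of [dotL2]: complex L2 is treated as a real Hilbert space, and [mulI] restores the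
    complex structure. *)
Definition ip f g : R := \int[mu]_x (Re (f x) * Re (g x) + Im (f x) * Im (g x)).

Definition lin (a : R[i]) f g : R -> R[i] := fun x => a * f x + g x.

(** Multiplication by i; it makes [ip f (mulI g)] the imaginary part of [dotL2 f g]. *)
Definition mulI f : R -> R[i] := fun x => Complex (- Im (f x)) (Re (f x)).

Lemma Re_lin a f g x : Re (lin a f g x) = Re a * Re (f x) - Im a * Im (f x) + Re (g x).
Proof. by rewrite /lin; case: a => ? ?; case: (f x) => ? ?; case: (g x). Qed.

Lemma Im_lin a f g x : Im (lin a f g x) = Re a * Im (f x) + Im a * Re (f x) + Im (g x).
Proof. by rewrite /lin; case: a => ? ?; case: (f x) => ? ?; case: (g x). Qed.

Lemma dotL2E f g : dotL2 f g = Complex (ip f g) (ip f (mulI g)).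
Proof.
congr Complex; apply: eq_Rintegral => x _.
  by case: (f x) => a b; case: (g x) => c d /=; ring.
by rewrite /mulI; case: (f x) => a b; case: (g x) => c d /=; ring.
Qed.

Lemma ipC f g : ip f g = ip g f.
Proof. by apply: eq_Rintegral => x _; ring. Qed.

Lemma ip_mulI f g : ip (mulI f) (mulI g) = ip f g.
Proof. by apply: eq_Rintegral => x _ /=; ring. Qed.

Lemma ip_ge0 f : 0 <= ip f f.
Proof. by apply: Rintegral_ge0 => x _; rewrite -!expr2 addr_ge0 // sqr_ge0. Qed.

Lemma normc_sqr (z : R[i]) : Normc.normc z ^+ 2 = Re z ^+ 2 + Im z ^+ 2.
Proof. by case: z => a b /=; rewrite sqr_sqrtr // addr_ge0 // sqr_ge0. Qed.

Lemma L2P f : L2 f <->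
  [/\ measurable_fun setT (fun x => Re (f x)),
      measurable_fun setT (fun x => Im (f x)) &
      mu.-integrable setT (EFin \o (fun x => Re (f x) ^+ 2 + Im (f x) ^+ 2))].
Proof.
have E : sqnorm f = (\int[mu]_x (`|Re (f x) ^+ 2 + Im (f x) ^+ 2|)%:E)%E.
  apply: eq_integral => x _; congr EFin; rewrite normc_sqr ger0_norm //.
  by rewrite addr_ge0 // sqr_ge0.
split=> [[[mR mI] fin]|[mR mI /integrableP[_ fin]]].
  split=> //; apply/integrableP; split; last by rewrite -E.
  apply/measurable_EFinP; apply: measurable_funD; exact: measurable_funX.
by split=> //; rewrite E.
Qed.

Lemma integrable_ip f g : L2 f -> L2 g ->
  mu.-integrable setT
    (EFin \o (fun x => Re (f x) * Re (g x) + Im (f x) * Im (g x))).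
Proof.
move=> /L2P[fR fI fi] /L2P[gR gI gi].
apply: (le_integrable measurableT _ _ (integrableD measurableT fi gi)).
  apply/measurable_EFinP; apply: measurable_funD; exact: measurable_funM.
move=> x _; rewrite /= lee_fin [leRHS]ger0_norm ?addr_ge0 ?sqr_ge0 //.
rewrite ler_norml; apply/andP; split.
  have := sqr_ge0 (Re (f x) + Re (g x)); have := sqr_ge0 (Im (f x) + Im (g x)).
  have := sqr_ge0 (Re (f x)); have := sqr_ge0 (Re (g x)).
  have := sqr_ge0 (Im (f x)); have := sqr_ge0 (Im (g x)); lra.
have := sqr_ge0 (Re (f x) - Re (g x)); have := sqr_ge0 (Im (f x) - Im (g x)).
have := sqr_ge0 (Re (f x)); have := sqr_ge0 (Re (g x)).
have := sqr_ge0 (Im (f x)); have := sqr_ge0 (Im (g x)); lra.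
Qed.

Lemma L2_mulI f : L2 f -> L2 (mulI f).
Proof.
move=> /L2P[fR fI fi]; apply/L2P; split=> //=; first exact: measurableT_comp.
by under eq_fun do rewrite sqrrN addrC.
Qed.

Lemma L2_lin a f g : L2 f -> L2 g -> L2 (lin a f g).
Proof.
move=> /L2P[fR fI fi] /L2P[gR gI gi]; apply/L2P.
have mlR : measurable_fun setT (fun x => Re (lin a f g x)).
  under eq_fun do rewrite Re_lin.
  apply: measurable_funD => //; apply: measurable_funB; exact: measurable_funM.
have mlI : measurable_fun setT (fun x => Im (lin a f g x)).
  under eq_fun do rewrite Im_lin.
  apply: measurable_funD => //; apply: measurable_funD; exact: measurable_funM.
split=> //.
(* Integrable majorant from |a f + g|^2 <= 2 |a|^2 |f|^2 + 2 |g|^2. *)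
have h := integrableD measurableT
  (integrableZl measurableT (2 * (Re a ^+ 2 + Im a ^+ 2)) fi)
  (integrableZl measurableT 2 gi).
apply: (le_integrable measurableT _ _ h).
  apply/measurable_EFinP; apply: measurable_funD; exact: measurable_funX.
move=> x _; rewrite /= lee_fin !ger0_norm ?addr_ge0 ?sqr_ge0 ?mulr_ge0 ?addr_ge0 ?sqr_ge0 //.
rewrite Re_lin Im_lin.
set ar := Re a; set ai := Im a; set fr := Re (f x); set fi' := Im (f x).
set gr := Re (g x); set gi' := Im (g x).
have := sqr_ge0 (ar * fr - ai * fi' - gr).
have := sqr_ge0 (ar * fi' + ai * fr - gi').
have -> : 2 * (ar ^+ 2 + ai ^+ 2) * (fr ^+ 2 + fi' ^+ 2) =
  2 * ((ar * fr - ai * fi') ^+ 2 + (ar * fi' + ai * fr) ^+ 2) by ring.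
move: (ar * fr - ai * fi') (ar * fi' + ai * fr) => X Y; lra.
Qed.

Lemma ip_lin a f g h : L2 f -> L2 g -> L2 h ->
  ip (lin a f g) h = Re a * ip f h + Im a * ip (mulI f) h + ip g h.
Proof.
move=> Lf Lg Lh; rewrite /ip -!RintegralZl //; last 2 first.
- exact: (integrable_ip (L2_mulI Lf) Lh).
- exact: integrable_ip.
have i1 := integrableZl measurableT (Re a) (integrable_ip Lf Lh).
have i2 := integrableZl measurableT (Im a) (integrable_ip (L2_mulI Lf) Lh).
have i3 := integrable_ip Lg Lh.
rewrite -RintegralD // -RintegralD //; last exact: (integrableD measurableT i1 i2).
by apply: eq_Rintegral => x _; rewrite Re_lin Im_lin /=; ring.
Qed.

Lemma ip_linr a f g h : L2 f -> L2 g -> L2 h ->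
  ip h (lin a f g) = Re a * ip h f + Im a * ip h (mulI f) + ip h g.
Proof. by move=> *; rewrite ipC ip_lin // ![ip _ h]ipC. Qed.

Lemma ip_mulIl f g : L2 f -> L2 g -> ip (mulI f) g = - ip f (mulI g).
Proof.
move=> Lf Lg; rewrite -[RHS]mulN1r /ip -RintegralZl //; last first.
  exact: (integrable_ip Lf (L2_mulI Lg)).
by apply: eq_Rintegral => x _ /=; ring.
Qed.

Lemma aeq_refl f : aeq f f. Proof. exact: aeW. Qed.

Lemma aeq_sym f g : aeq f g -> aeq g f.
Proof. by apply: aeS => x. Qed.

Lemma aeq_trans g f h : aeq f g -> aeq g h -> aeq f h.
Proof. by apply: aeS2 => x -> ->. Qed.

Lemma aeq_lin a f f' g g' : aeq f f' -> aeq g g' -> aeq (lin a f g) (lin a f' g').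
Proof. by apply: aeS2 => x; rewrite /lin => -> ->. Qed.

Lemma ip_aeq f f' g g' : L2 f -> L2 f' -> L2 g -> L2 g' ->
  aeq f f' -> aeq g g' -> ip f g = ip f' g'.
Proof.
move=> Lf Lf' Lg Lg' ff gg; congr fine; apply: ae_eq_integral => //.
- by case/integrableP: (integrable_ip Lf Lg).
- by case/integrableP: (integrable_ip Lf' Lg').
- by apply: aeS2 ff gg => x -> -> _.
Qed.

Lemma L2_0 : L2 (fun=> 0 : R[i]).
Proof.
apply/L2P; split=> //=; rewrite expr0n /= addr0.
exact: integrable0.
Qed.

Lemma ip0 f : ip (fun=> 0) f = 0.
Proof.
rewrite /ip; under eq_Rintegral do rewrite !mul0r addr0.
by rewrite /Rintegral integral0.
Qed.

Lemma ip_eq0 f : L2 f -> ip f f = 0 -> aeq f (fun=> 0).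
Proof.
move=> Lf f0.
pose F x := Re (f x) * Re (f x) + Im (f x) * Im (f x).
have ii : mu.-integrable setT (EFin \o F) := integrable_ip Lf Lf.
have mi : measurable_fun setT (EFin \o F) by case/integrableP: ii.
have : (\int[mu]_x `|(EFin \o F) x|)%E = 0%E.
  rewrite -[RHS]/((0 : R)%:E) -f0 /ip fineK; last exact: integrable_fin_num.
  apply: eq_integral => x _ /=; rewrite ger0_norm //.
  by rewrite /F -!expr2 addr_ge0 // sqr_ge0.
move/(ae_eq_integral_abs mu measurableT mi); apply: aeS => x /(_ I) [].
rewrite /= /F -!expr2 => /eqP; rewrite paddr_eq0 ?sqr_ge0 // !sqrf_eq0.
by case: (f x) => a b /= /andP[/eqP -> /eqP ->].
Qed.

End inner_product.

(** * Moments of finite measures concentrated on a bounded set *)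

Section concentrated_measure.
Context {R : realType}.
Variables (mu : {measure set R -> \bar R}) (B : set R) (K : R).
Hypotheses (mB : measurable B) (muB : mu (~` B) = 0%E) (K0 : 0 <= K)
  (BK : forall l, B l -> `|l| <= K) (mufin : mu setT \is a fin_num).

Lemma concentrated_ae (P : R -> Prop) : (forall l, B l -> P l) ->
  {ae mu, forall l, P l}.
Proof.
move=> BP; exists (~` B); split=> //; first exact: measurableC.
by move=> l /= nP; apply: contra_not nP; exact: BP.
Qed.

Lemma concentrated_integral_le (g : R -> R) (M : R) : measurable_fun setT g ->
  0 <= M -> (forall l, 0 <= g l) -> (forall l, B l -> g l <= M) ->
  (\int[mu]_l (g l)%:E <= (M * fine (mu setT))%:E)%E.
Proof.
move=> mg M0 g0 gM; rewrite EFinM fineK // -integral_cst //.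
apply: ae_ge0_le_integral => //.
- by move=> l _; rewrite lee_fin.
- exact/measurable_EFinP.
- apply: (@concentrated_ae (fun l => setT l -> ((g l)%:E <= M%:E)%E)) => l Bl _.
  by rewrite lee_fin gM.
Qed.

Lemma concentrated_sqr : (\int[mu]_l (l ^+ 2)%:E < +oo)%E.
Proof.
apply: le_lt_trans (ltry (K ^+ 2 * fine (mu setT))).
apply: concentrated_integral_le => [|||l Bl]; rewrite ?exprn_ge0 //.
- by move=> l; rewrite sqr_ge0.
- by rewrite -real_normK ?num_real // lerXn2r ?nnegrE // BK.
Qed.

Lemma concentrated_integrable : mu.-integrable setT (EFin \o (@id R)).
Proof.
apply/integrableP; split; first exact/measurable_EFinP.
apply: le_lt_trans (ltry (K * fine (mu setT))).
have := @concentrated_integral_le (fun l => `|l|) K; exact.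
Qed.

Lemma concentrated_mean : (forall l, B l -> 0 <= l) ->
  0 <= \int[mu]_l l <= K * fine (mu setT).
Proof.
move=> B0.
(* The identity is known to be nonnegative only on [B]; passing to [|l|] gives access to the
   estimate for nonnegative functions. *)
have -> : \int[mu]_l l = \int[mu]_l `|l|.
  congr fine; apply: ae_eq_integral => //.
    by apply/measurable_EFinP; exact: normr_measurable.
  apply: (@concentrated_ae (fun l => setT l -> l%:E = `|l|%:E)) => l Bl _.
  by rewrite ger0_norm // B0.
rewrite Rintegral_ge0 //=.
have H : (\int[mu]_l `|l|%:E <= (K * fine (mu setT))%:E)%E.
  exact: (@concentrated_integral_le (fun l => `|l|) K).
rewrite -lee_fin fineK // ge0_fin_numE; first exact: le_lt_trans H (ltry _).
by apply: integral_ge0 => l _; rewrite lee_fin.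
Qed.

End concentrated_measure.

(** * Spectral subspaces of a linear operator given by its graph *)

Section spectral.
Context {R : realType}.
Variables (A : (R -> R[i]) -> (R -> R[i]) -> Prop) (E : @set_op R).
Hypotheses
  (A_L2 : forall f u, A f u -> L2 f /\ L2 u)
  (A_lin : forall a f u g w, A f u -> A g w -> A (lin a f g) (lin a u w))
  (sE : spectral_measure_of A E).
Implicit Types (f g u w : R -> R[i]) (B C D : set R).

Let projE B : measurable B -> orth_proj (E B).
Proof. by case: sE => [[+ _ _ _ _] _]; apply. Qed.

Lemma E_L2 B f : measurable B -> L2 f -> L2 (E B f).
Proof. by move=> /projE[+ _ _ _ _]; apply. Qed.

Lemma E_aeq B f g : measurable B -> L2 f -> L2 g -> aeq f g -> aeq (E B f) (E B g).
Proof. by move=> /projE[_ + _ _ _]; apply. Qed.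

Lemma E_lin B a f g : measurable B -> L2 f -> L2 g ->
  aeq (E B (lin a f g)) (lin a (E B f) (E B g)).
Proof. by move=> /projE[_ _ + _ _]; apply. Qed.

Lemma E_idem B f : measurable B -> L2 f -> aeq (E B (E B f)) (E B f).
Proof. by move=> /projE[_ _ _ + _]; apply. Qed.

Lemma E_ip B f g : measurable B -> L2 f -> L2 g -> ip (E B f) g = ip f (E B g).
Proof.
move=> /projE[_ _ _ _ H] Lf Lg; have := H f g Lf Lg.
by rewrite !dotL2E => -[].
Qed.

Lemma E_setI B C f : measurable B -> measurable C -> L2 f ->
  aeq (E (B `&` C) f) (E B (E C f)).
Proof. by case: sE => [[_ _ _ + _] _]; apply. Qed.

Lemma E_set0 f : L2 f -> aeq (E set0 f) (fun=> 0).
Proof. by case: sE => [[_ + _ _ _] _]; apply. Qed.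

Lemma E_setT f : L2 f -> aeq (E setT f) f.
Proof. by case: sE => [[_ _ + _ _] _]; apply. Qed.

(** [E C f] agrees with [E C (E B f)], hence with the projection for the intersection, which is
    empty. *)
Lemma E_range_disjoint B C f : measurable B -> measurable C -> L2 f ->
  aeq (E B f) f -> C `&` B = set0 -> aeq (E C f) (fun=> 0).
Proof.
move=> mB mC Lf Bf CB; apply: aeq_trans (E_set0 Lf).
rewrite -CB; apply: aeq_sym; apply: aeq_trans (E_setI mC mB Lf) _.
by apply: E_aeq => //; exact: E_L2.
Qed.

Lemma ip_range_disjoint B C f g : measurable B -> measurable C -> L2 f -> L2 g ->
  aeq (E B f) f -> aeq (E C g) g -> B `&` C = set0 -> ip f g = 0.
Proof.
move=> mB mC Lf Lg Bf Cg BC.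
have -> : ip f g = ip (E B f) g by apply: ip_aeq => //; [exact: E_L2|exact: aeq_sym|exact: aeq_refl].
rewrite E_ip // ipC -(ip0 f); apply: ip_aeq => //; last exact: aeq_refl.
- exact: E_L2.
- exact: L2_0.
- exact: E_range_disjoint Cg BC.
Qed.

Lemma E_range B C f : measurable B -> measurable C -> L2 f -> aeq (E B f) f ->
  aeq (E B (E C f)) (E C f).
Proof.
move=> mB mC Lf Bf.
have BC : aeq (E (C `&` B) f) (E C f).
  by apply: aeq_trans (E_setI mC mB Lf) _; apply: E_aeq => //; exact: E_L2.
by apply: aeq_trans BC; rewrite setIC; apply: aeq_sym; exact: E_setI.
Qed.

(** The equation [ip u (mulI f) = 0] records that the quadratic form of [A] is real, being a real
    integral. *)
Lemma scalar_measure_ex f : L2 f -> exists mu : {measure set R -> \bar R},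
  [/\ (forall B, measurable B -> mu B = (ip (E B f) f)%:E),
      ((exists u, A f u) <-> (\int[mu]_l (l ^+ 2)%:E < +oo)%E) &
      (forall u, A f u -> ip u f = \int[mu]_l l /\ ip u (mulI f) = 0)].
Proof.
move=> Lf; have [mu smu [dom Amu]] := sE.2 f Lf.
exists mu; split=> //.
  by move=> B mB; rewrite smu // dotL2E.
by move=> u /Amu; rewrite dotL2E => -[].
Qed.

Lemma scalar_measure_setT f (mu : {measure set R -> \bar R}) : L2 f ->
  (forall B, measurable B -> mu B = (ip (E B f) f)%:E) -> mu setT = (ip f f)%:E.
Proof.
move=> Lf -> //; congr EFin; apply: ip_aeq => //; first exact: E_L2.
- exact: E_setT.
- exact: aeq_refl.
Qed.

Lemma scalar_measure_setC f B (mu : {measure set R -> \bar R}) : L2 f ->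
  measurable B -> aeq (E B f) f ->
  (forall B, measurable B -> mu B = (ip (E B f) f)%:E) -> mu (~` B) = 0%E.
Proof.
move=> Lf mB Bf smu; have mC : measurable (~` B) by exact: measurableC.
rewrite smu //; congr EFin; rewrite -(ip0 f); apply: ip_aeq => //.
- exact: E_L2.
- exact: L2_0.
- by apply: (E_range_disjoint mB) => //; rewrite setICl.
- exact: aeq_refl.
Qed.

(** Polarization: the quadratic form is real at f, at g and at f + i g, and the imaginary cross
    terms that remain give the symmetry. *)
Lemma A_symmetric f u g w : A f u -> A g w -> ip u g = ip f w.
Proof.
have real0 f' u' : A f' u' -> ip u' (mulI f') = 0.
  move=> Af; have [Lf _] := A_L2 Af.
  by have [mu [_ _ /(_ _ Af)[]]] := scalar_measure_ex Lf.
move=> Af Ag; have [Lf Lu] := A_L2 Af; have [Lg Lw] := A_L2 Ag.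
have := real0 _ _ (A_lin (Complex 0 1) Ag Af).
have Li := L2_mulI (L2_lin (Complex 0 1) Lg Lf).
rewrite ip_lin //= mul0r mul1r add0r ip_mulI.
have LI f' : L2 f' -> L2 (mulI f') by exact: L2_mulI.
have Ll := L2_lin (Complex 0 1) Lg Lf.
rewrite ip_linr //= mul0r mul1r add0r.
rewrite -[ip u _]opprK -ip_mulIl // ip_linr //=; last exact: LI.
rewrite mul0r mul1r add0r ip_mulI (ip_mulIl Lu Lf) (real0 _ _ Af) (real0 _ _ Ag).
by rewrite oppr0 addr0 add0r [ip w f]ipC => /eqP; rewrite subr_eq0 => /eqP.
Qed.

(** The scalar measure of [f] lives on the bounded set [B], so its second moment, which decides
    membership in the domain, is finite. *)
Lemma domain_of_bounded B K f : measurable B -> 0 <= K ->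
  (forall l, B l -> `|l| <= K) -> L2 f -> aeq (E B f) f -> exists u, A f u.
Proof.
move=> mB K0 BK Lf Bf; have [mu [smu dom _]] := scalar_measure_ex Lf.
apply/dom; apply: (@concentrated_sqr _ mu B K) => //.
- exact: scalar_measure_setC Bf smu.
- by rewrite (scalar_measure_setT Lf smu).
Qed.

(* The scalar measures of f, g and f + g satisfy mu_(f+g) = mu_f + mu_g, so the
   quadratic form of A is additive on f + g and the cross terms vanish. *)
Lemma A_range_disjoint B C K f u g : measurable B -> measurable C -> 0 <= K ->
  (forall l, B l -> `|l| <= K) -> (forall l, C l -> `|l| <= K) ->
  L2 f -> L2 g -> aeq (E B f) f -> aeq (E C g) g -> B `&` C = set0 ->
  A f u -> ip u g = 0.
Proof.
move=> mB mC K0 BK CK Lf Lg Bf Cg BC Af.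
have [w Ag] := domain_of_bounded mC K0 CK Lg Cg.
have [_ Lu] := A_L2 Af; have [_ Lw] := A_L2 Ag; have LIu := L2_mulI Lu.
have Ah := A_lin (Complex 1 0) Af Ag; have [Lh Luw] := A_L2 Ah.
have [mf [smf _ /(_ _ Af)[If _]]] := scalar_measure_ex Lf.
have [mg [smg _ /(_ _ Ag)[Ig _]]] := scalar_measure_ex Lg.
have [mh [smh _ /(_ _ Ah)[Ih _]]] := scalar_measure_ex Lh.
(* [E D f] remains in the range of [E B], which is orthogonal to that of [E C]. *)
have cross D : measurable D -> ip (E D f) g = 0.
  move=> mD; apply: (ip_range_disjoint mB mC) => //; first exact: E_L2.
  exact: E_range.
have mhE D : measurable D -> mh D = measure_add mf mg D.
  move=> mD; rewrite measure_addE smh // smf // smg // -EFinD; congr EFin.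
  rewrite (ip_aeq (f' := lin (Complex 1 0) (E D f) (E D g)) (g' := lin (Complex 1 0) f g)) //; first last.
  - exact: aeq_refl.
  - exact: E_lin.
  - by apply: L2_lin; exact: E_L2.
  - exact: E_L2.
  have LDf := E_L2 mD Lf; have LDg := E_L2 mD Lg; have LIDf := L2_mulI LDf.
  rewrite ip_lin // !ip_linr //= !mul1r !mul0r !addr0 cross // addr0.
  by rewrite (E_ip mD Lg Lf) [ip g _]ipC cross // add0r.
have intf : mf.-integrable setT (EFin \o (@id R)).
  apply: (concentrated_integrable mB _ K0 BK).
  - exact: scalar_measure_setC Bf smf.
  - by rewrite (scalar_measure_setT Lf smf).
have intg : mg.-integrable setT (EFin \o (@id R)).
  apply: (concentrated_integrable mC _ K0 CK).
  - exact: scalar_measure_setC Cg smg.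
  - by rewrite (scalar_measure_setT Lg smg).
have : \int[mh]_l l = \int[mf]_l l + \int[mg]_l l.
  rewrite /Rintegral (eq_measure_integral (measure_add mf mg)); last first.
    by move=> D mD _; exact: mhE.
  rewrite (integral_measure_add measurableT intf intg) fineD //.
  - exact: integrable_fin_num intf.
  - exact: integrable_fin_num intg.
rewrite -If -Ig -Ih ip_lin // !ip_linr //= !mul1r !mul0r !addr0.
(* Additivity makes the two cross terms sum to 0, and symmetry makes them equal. *)
have := A_symmetric Af Ag; rewrite [ip f w]ipC => ->; lra.
Qed.

(** Without mass outside [B], |E B f|^2 = <E B f, f> = |f|^2, and expanding |f - E B f|^2 gives
    0. *)
Lemma E_range_of_measure_setC B f (mu : {measure set R -> \bar R}) : L2 f ->
  measurable B -> (forall D, measurable D -> mu D = (ip (E D f) f)%:E) ->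
  mu (~` B) = 0%E -> aeq (E B f) f.
Proof.
move=> Lf mB smu muC.
have LB := E_L2 mB Lf.
have EBf : ip (E B f) f = ip f f.
  apply: EFin_inj; rewrite -smu // -(scalar_measure_setT Lf smu).
  transitivity (mu B + mu (~` B))%E; first by rewrite muC adde0.
  by rewrite -(setUv B) measureU ?setICr //; exact: measurableC.
have EBB : ip (E B f) (E B f) = ip (E B f) f.
  rewrite (E_ip mB Lf LB) ipC; apply: ip_aeq => //; first exact: E_L2.
    exact: E_idem.
  exact: aeq_refl.
have LI := L2_mulI LB.
have Ld := L2_lin (Complex (-1) 0) LB Lf.
have : ip (lin (Complex (-1) 0) (E B f) f) (lin (Complex (-1) 0) (E B f) f) = 0.
  rewrite ip_lin // !ip_linr //= !mulN1r !mul0r !addr0 EBB [ip f _]ipC EBf; lra.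
move/(ip_eq0 Ld); apply: aeS => x.
rewrite /lin; case: (f x) => a b; case: (E B f x) => c d /=.
by move=> -[] ? ?; congr Complex; lra.
Qed.

Variable Omega : R.
Hypothesis Omega_gt0 : 0 < Omega.
Local Notation J := `[0, Omega ^+ 2]%classic.

Let mJ : measurable J. Proof. exact: measurable_itv. Qed.

Let O2_ge0 : 0 <= Omega ^+ 2. Proof. by rewrite sqr_ge0. Qed.

Let J_bound l : J l -> `|l| <= Omega ^+ 2.
Proof. by rewrite /= in_itv /= => /andP[l0 lO]; rewrite ger0_norm. Qed.

Let inPW f := L2 f /\ aeq (E J f) f.

(** By [A_range_disjoint], [u] is orthogonal to the ranges of [E (C n)], where the [C n] exhaust the
    complement of [J]; so the scalar measure of [u] has no mass there. Bounded pieces are used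
    because their spectral subspaces lie in the domain. *)
Lemma A_invariant f u : inPW f -> A f u -> inPW u.
Proof.
move=> [Lf Jf] Af; have [_ Lu] := A_L2 Af; split=> //.
have [mu [smu _ _]] := scalar_measure_ex Lu.
apply: (E_range_of_measure_setC Lu mJ smu).
pose C n := `[- n%:R, n%:R]%classic `\` J : set R.
have mC n : measurable (C n) by apply: measurableD; exact: measurable_itv.
have C0 n : mu (C n) = 0%E.
  rewrite smu //; congr EFin; rewrite ipC.
  pose K := Num.max (Omega ^+ 2) n%:R.
  have LC := E_L2 (mC n) Lu.
  apply: (@A_range_disjoint J (C n) K f) => //.
  - by rewrite le_max O2_ge0.
  - by move=> l /J_bound lO; rewrite le_max lO.
  - move=> l [+ _]; rewrite /= in_itv /= => /andP[l1 l2].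
    by rewrite le_max [X in _ || X]ler_norml l1 l2 orbT.
  - exact: E_idem.
  - by rewrite /C setDE setICA setICr setI0.
have -> : ~` J = \bigcup_n C n.
  apply/seteqP; split=> [l nJl|l [n _ []]] //.
  exists (Num.Def.archi_bound `|l|) => //; split=> //.
  rewrite /= in_itv /= -ler_norml ltW // archi_boundP //.
have mCU : measurable (\bigcup_n C n) by exact: bigcupT_measurable.
apply/(negligibleP mu mCU); apply: negligible_bigcup => n.
exact: (negligibleP mu (mC n)).2 (C0 n).
Qed.

(** [ip u f] is the mean of a measure of total mass [ip f f] concentrated on the interval from 0 to
    [Omega ^+ 2]. *)
Lemma A_form_bounds f u : inPW f -> A f u ->
  0 <= ip u f <= Omega ^+ 2 * ip f f.
Proof.
move=> [Lf Jf] Af; have [mu [smu _ /(_ _ Af)[-> _]]] := scalar_measure_ex Lf.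
have muT := scalar_measure_setT Lf smu.
have -> : ip f f = fine (mu setT) by rewrite muT.
apply: (@concentrated_mean _ mu J) => //.
- exact: scalar_measure_setC Jf smu.
- by rewrite muT.
- by move=> l; rewrite /= in_itv /= => /andP[].
Qed.

(* Positivity of the form of A at f - s u with s = Omega^-2, u = A f. *)
Lemma A_norm_le f u : inPW f -> A f u -> ip u u <= (Omega ^+ 2) ^+ 2 * ip f f.
Proof.
move=> PWf Af; have PWu := A_invariant PWf Af.
have [Lu Ju] := PWu; have [Lf Jf] := PWf.
have [w Aw] := domain_of_bounded mJ O2_ge0 J_bound Lu Ju.
have [_ Lw] := A_L2 Aw.
have O0 : 0 < Omega ^+ 2 by rewrite exprn_gt0.
pose s := (Omega ^+ 2)^-1.
have s0 : 0 < s by rewrite invr_gt0.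
have Ad := A_lin (Complex (- s) 0) Aw Af.
have Ld := L2_lin (Complex (- s) 0) Lu Lf.
have PWd : inPW (lin (Complex (- s) 0) u f).
  split=> //; apply: aeq_trans (E_lin _ mJ Lu Lf) _; exact: aeq_lin.
have /andP[+ _] := A_form_bounds PWd Ad.
have LIw := L2_mulI Lw; have LIu := L2_mulI Lu.
rewrite ip_lin // !ip_linr //= !mul0r !addr0 [ip w f]ipC -(A_symmetric Af Aw).
have /andP[_ uf] := A_form_bounds PWf Af.
have /andP[_ wu] := A_form_bounds PWu Aw.
set U := ip u u in wu *; set F := ip f f in uf *; move=> H.
(* Here [H] reads 0 <= s^2 <w, u> - 2 s |u|^2 + <u, f>, where [w] is A u. The bound <w, u> <=
   Omega^2 |u|^2 absorbs one term s |u|^2 and leaves s |u|^2 <= <u, f>. *)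
have h1 : s * (s * ip w u) <= s * U.
  rewrite ler_pM2l // /s ler_pdivrMl //.
have : s * U <= Omega ^+ 2 * F by lra.
by rewrite /s ler_pdivrMl // mulrA -expr2.
Qed.

Lemma A_chain f : inPW f -> exists u : nat -> R -> R[i],
  [/\ u 0%N = f, (forall k, A (u k) (u k.+1)) &
      (forall k, ip (u k) (u k) <= ((Omega ^+ 2) ^+ k) ^+ 2 * ip f f)].
Proof.
move=> PWf.
have [F FP] : exists F : (R -> R[i]) -> (R -> R[i]),
    forall g, inPW g -> A g (F g).
  (* Outside the spectral subspace the chosen value is arbitrary; by [A_invariant] the iteration
     never leaves that subspace. *)
  have /choice[F FP] : forall g, exists u, inPW g -> A g u.
    move=> g; have [[Lg Jg]|] := pselect (inPW g); last by exists g.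
    by have [u Au] := domain_of_bounded mJ O2_ge0 J_bound Lg Jg; exists u.
  by exists F.
have PWk k : inPW (iter k F f).
  by elim: k => // k IH /=; apply: A_invariant IH (FP _ IH).
exists (fun k => iter k F f); split=> // k; first exact: FP.
elim: k => [|k IH]; first by rewrite expr0 expr1n mul1r.
apply: le_trans (A_norm_le (PWk k) (FP _ (PWk k))) _.
by rewrite (exprS _ k) [(_ * _ ^+ k) ^+ 2]exprMn -[leRHS]mulrA ler_wpM2l // sqr_ge0.
Qed.

End spectral.

(** * From the Sturm-Liouville operator to real chains *)

Section sturm_liouville.
Context {R : realType}.
Notation mu := (@lebesgue_measure R).
Local Notation Re := complex.Re.
Local Notation Im := complex.Im.
Implicit Types (p : R -> R) (f g h u w : R -> R[i]).

Lemma normc_nneg (z : R[i]) : 0 <= Normc.normc z.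
Proof. by case: z => a b; exact: sqrtr_ge0. Qed.

Lemma Re_le_normc (z : R[i]) : `|Re z| <= Normc.normc z.
Proof.
rewrite -(@ler_pXn2r _ 2) ?nnegrE ?normr_ge0 ?normc_nneg //.
by rewrite normc_sqr real_normK ?num_real // lerDl sqr_ge0.
Qed.

Lemma AC_loc_Re f : AC_loc f -> forall a b, a <= b -> real_AC a b (fun x => Re (f x)).
Proof.
move=> acf a b ab e e0; have [d d0 dP] := acf a b ab e e0.
exists d => // n s t st dis sd; apply: le_lt_trans (dP n s t st dis sd).
apply: ler_sum => i _; rewrite (_ : Re _ - Re _ = Re (f (t i) - f (s i))).
  exact: Re_le_normc.
by case: (f (t i)) => ? ?; case: (f (s i)).
Qed.

Lemma AC_loc_lin a f g : AC_loc f -> AC_loc g -> AC_loc (lin a f g).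
Proof.
move=> acf acg x y xy e e0.
(* The [+ 1] keeps this divisor positive when [a = 0]. *)
have na : 0 < Normc.normc a + 1 by rewrite ltr_wpDl // normc_nneg.
have [d d0 dP] := acf x y xy _ (divr_gt0 (divr_gt0 e0 (ltr0Sn _ 1)) na).
have [d' d'0 d'P] := acg x y xy _ (divr_gt0 e0 (ltr0Sn _ 1)).
exists (Num.min d d'); first by rewrite lt_min d0.
move=> n s t st dis; rewrite lt_min => /andP[sd sd'].
have {dP} h1 := dP n s t st dis sd; have {d'P} h2 := d'P n s t st dis sd'.
apply: (@le_lt_trans _ _ (Normc.normc a * \sum_(i < n) Normc.normc (f (t i) - f (s i))
   + \sum_(i < n) Normc.normc (g (t i) - g (s i)))).
  rewrite mulr_sumr -big_split /=; apply: ler_sum => i _.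
  rewrite -Normc.normcM.
  have -> : lin a f g (t i) - lin a f g (s i) =
      a * (f (t i) - f (s i)) + (g (t i) - g (s i)) by rewrite /lin; ring.
  exact: le_normcD.
set S := \sum_(_ < _) _ in h1 *; set T := \sum_(_ < _) _ in h2 *.
have S0 : 0 <= S by apply: sumr_ge0 => i _; exact: normc_nneg.
move: h1; rewrite ltr_pdivlMr // mulrDr mulr1 mulrC; lra.
Qed.

Lemma is_deriveC_lin a f g (x : R) (v w : R[i]) :
  is_deriveC x f v -> is_deriveC x g w -> is_deriveC x (lin a f g) (a * v + w).
Proof.
move=> [fR fI] [gR gI]; split.
  have -> : (fun y => Re (lin a f g y)) =
     (fun y => Re a * Re (f y) - Im a * Im (f y) + Re (g y)).
    by apply/funext => y; rewrite Re_lin.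
  have -> : Re (a * v + w) = Re a * Re v - Im a * Im v + Re w.
    exact: (Re_lin a (cst v) (cst w) x).
  exact: (is_deriveD (is_deriveB (is_derive_mull _ fR) (is_derive_mull _ fI)) gR).
have -> : (fun y => Im (lin a f g y)) =
   (fun y => Re a * Im (f y) + Im a * Re (f y) + Im (g y)).
  by apply/funext => y; rewrite Im_lin.
have -> : Im (a * v + w) = Re a * Im v + Im a * Re v + Im w.
  exact: (Im_lin a (cst v) (cst w) x).
exact: (is_deriveD (is_deriveD (is_derive_mull _ fI) (is_derive_mull _ fR)) gI).
Qed.

Lemma tau_lin p a f u g w : tau p f u -> tau p g w -> tau p (lin a f g) (lin a u w).
Proof.
move=> [acf [h ach [fh hu]]] [acg [k ack [gk kw]]].
split; first exact: AC_loc_lin.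
exists (lin a h k); first exact: AC_loc_lin.
split.
  apply: aeS2 fh gk => x [v fv hv] [z gz kz].
  exists (a * v + z); first exact: is_deriveC_lin.
  by rewrite /lin hv kz; ring.
apply: aeS2 hu kw => x hx kx.
have -> : - lin a u w x = a * (- u x) + (- w x) by rewrite /lin; ring.
exact: is_deriveC_lin.
Qed.

Lemma SLop_L2 p f u : SLop p f u -> L2 f /\ L2 u.
Proof. by case. Qed.

Lemma SLop_lin p a f u g w : SLop p f u -> SLop p g w -> SLop p (lin a f g) (lin a u w).
Proof.
move=> [Lf Lu [f0 ff0 tf]] [Lg Lw [g0 gg0 tg]].
split; [exact: L2_lin|exact: L2_lin|].
by exists (lin a f0 g0); [exact: aeq_lin|exact: tau_lin].
Qed.

(** Since [p] is real, the real parts of the absolutely continuous representatives and of their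
    quasi-derivatives satisfy the same equations; [u k.+1] may be replaced by its representative
    almost everywhere. *)
Lemma SLop_chain_real p (C m : R) (u : nat -> R -> R[i]) :
  (forall k, SLop p (u k) (u k.+1)) ->
  (forall k, ip (u k) (u k) <= C * (m ^+ k) ^+ 2) ->
  exists phi eta, L2_chain p C m phi eta /\
    forall k, {ae mu, forall x, Re (u k x) = phi k x}.
Proof.
move=> Su bd.
have /choice[fh fhP] : forall k, exists fh : (R -> R[i]) * (R -> R[i]),
  [/\ aeq (u k) fh.1, AC_loc fh.1, AC_loc fh.2,
    {ae mu, forall x,
      exists2 v, is_deriveC x fh.1 v & fh.2 x = (p x)%:C%C * v} &
    {ae mu, forall x, is_deriveC x fh.2 (- u k.+1 x)}].
  move=> k; have [_ _ [f0 uf0 [acf [h ach [D1 D2]]]]] := Su k.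
  by exists (f0, h).
exists (fun k x => Re ((fh k).1 x)), (fun k x => Re ((fh k).2 x)).
have ueq k : {ae mu, forall x, Re (u k x) = Re ((fh k).1 x)}.
  by have [e _ _ _ _] := fhP k; apply: aeS e => x ->.
split=> // k; have [e acf ach D1 D2] := fhP k.
have acR := AC_loc_Re acf.
split=> //; first exact: AC_loc_Re.
- apply: aeS D1 => x [v [vR _] ->]; exists (Re v) => //.
  by case: v {vR} => a b /=; ring.
- have [e' _ _ _ _] := fhP k.+1.
  apply: aeS2 D2 e' => x [+ _] <-.
  by case: (u k.+1 x).
- have [Lu _ _] := Su k; have /L2P[uR uI ui] := Lu.
  have mphi : measurable_fun setT (EFin \o (fun x => Re ((fh k).1 x) ^+ 2)).
    apply/measurable_EFinP; apply: measurable_funX.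
    by apply: continuous_measurable_fun; exact: real_AC_continuous.
  have le : (\int[mu]_x (Re ((fh k).1 x) ^+ 2)%:E <= (ip (u k) (u k))%:E)%E.
    have -> : (\int[mu]_x (Re ((fh k).1 x) ^+ 2)%:E =
               \int[mu]_x (Re (u k x) ^+ 2)%:E)%E.
      apply: ae_eq_integral => //.
        by apply/measurable_EFinP; exact: measurable_funX.
      by apply: aeS e => x -> _.
    rewrite fineK; last exact: integrable_fin_num (integrable_ip Lu Lu).
    apply: ge0_le_integral => //.
    + by move=> x _; rewrite lee_fin sqr_ge0.
    + by apply/measurable_EFinP; exact: measurable_funX.
    + by case/integrableP: (integrable_ip Lu Lu).
    + by move=> x _; rewrite lee_fin -!expr2 lerDl sqr_ge0.
  have ii : mu.-integrable setT (EFin \o (fun x => Re ((fh k).1 x) ^+ 2)).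
    apply/integrableP; split => //; apply: le_lt_trans (ltry (ip (u k) (u k))).
    apply: le_trans le; rewrite le_eqVlt; apply/orP; left; apply/eqP.
    by apply: eq_integral => x _ /=; rewrite ger0_norm // sqr_ge0.
  split=> //; apply: le_trans (bd k); rewrite -lee_fin.
  by rewrite /Rintegral fineK //; exact: integrable_fin_num ii.
Qed.

(** The lower bound is the least of finitely many positive values, valid off the nodes. *)
Lemma PC_ae_ge N p : PC N p -> exists2 c, 0 < c & {ae mu, forall x, c <= p x}.
Proof.
move=> [x [c [x0 xN _ c0 pc]]].
have [c' c'0 c'P] : exists2 c', 0 < c' & forall j, (j <= N)%N -> c' <= c j.
  have : forall n, (n <= N)%N -> exists2 c', 0 < c' & forall j, (j <= n)%N -> c' <= c j.
    elim=> [|n IH] nN.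
      by exists (c 0%N); [exact: c0|move=> j; rewrite leqn0 => /eqP ->].
    have [d d0 dP] := IH (ltnW nN).
    exists (Num.min d (c n.+1)); first by rewrite lt_min d0 c0.
    move=> j; rewrite leq_eqVlt => /predU1P[->|jn]; rewrite ge_min ?lexx ?orbT //.
    by rewrite dP.
  exact.
exists c' => //.
(* [fine] sends infinite values to 0, so the countable set discarded here may contain the extra
   point 0. *)
have nul : mu.-negligible (\bigcup_j [set fine (x j)]).
  apply: negligible_bigcup => j; apply/negligibleP; first exact: measurable_set1.
  exact: lebesgue_measure_set1.
apply: negligibleS nul => t /= cpt.
apply: contra_notP cpt => nt.
have tx j : x j <> t%:E by move=> E; apply: nt; exists j => //=; rewrite E.
(* Induction on [j] finds the interval containing [t]: descend while [t] lies left of the previous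
   node. *)
have : forall j, (j <= N.+1)%N -> (t%:E < x j)%E -> c' <= p t.
  elim=> [|j IH] jN; first by rewrite x0.
  have [tj _|] := ltP t%:E (x j); first exact: (IH (ltnW jN)).
  rewrite le_eqVlt => /predU1P[/tx//|xt] tx'.
  by rewrite (pc j t) // c'P.
by apply; [exact: leqnn|rewrite xN ltry].
Qed.

Lemma PW_chain p (Omega : R) f : 0 < Omega -> PW Omega p f ->
  exists u : nat -> R -> R[i],
  [/\ u 0%N = f, (forall k, SLop p (u k) (u k.+1)) &
      (forall k, ip (u k) (u k) <= ((Omega ^+ 2) ^+ k) ^+ 2 * ip f f)].
Proof.
move=> O0 [_ _ Lf [E sE fE]].
apply: (A_chain (@SLop_L2 p) (@SLop_lin p) sE O0).
by split=> //; exact: aeq_sym.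
Qed.

(** Parallelogram law with the term |f - g|^2 dropped. *)
Lemma ip_add_le f g : L2 f -> L2 g ->
  ip (lin (Complex 1 0) f g) (lin (Complex 1 0) f g) <= 2 * (ip f f + ip g g).
Proof.
move=> Lf Lg; have LIf := L2_mulI Lf.
have L1 := L2_lin (Complex 1 0) Lf Lg; have L2' := L2_lin (Complex (-1) 0) Lf Lg.
have := ip_ge0 (lin (Complex (-1) 0) f g).
rewrite !ip_lin // !ip_linr //= !mul1r !mulN1r !mul0r !addr0; lra.
Qed.

(** The memberships of [f] and [g] may come with different spectral measures, so the two chains are
    built separately and then added. *)
Lemma PW_add_unique_continuation N p (Omega t r : R) f g : PC N p -> 0 < Omega ->
  PW Omega p f -> PW Omega p g -> 0 < r ->
  (forall x, `|x - t| < r -> Re (f x) + Re (g x) = 0) ->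
  forall x, Re (f x) + Re (g x) = 0.
Proof.
move=> hp O0 PWf PWg r0 fg0.
have [c c0 pc] := PC_ae_ge hp.
have [u [u0 Su bu]] := PW_chain O0 PWf.
have [w [w0 Sw bw]] := PW_chain O0 PWg.
have [cf _ _ _] := PWf; have [cg _ _ _] := PWg.
pose s k := lin (Complex 1 0) (u k) (w k).
have Ss k : SLop p (s k) (s k.+1) by exact: SLop_lin.
have bs k : ip (s k) (s k) <= 2 * (ip f f + ip g g) * ((Omega ^+ 2) ^+ k) ^+ 2.
  have [Lu _] := SLop_L2 (Su k); have [Lw _] := SLop_L2 (Sw k).
  apply: le_trans (ip_add_le Lu Lw) _.
  by have := bu k; have := bw k; lra.
have [phi [eta [chain eqphi]]] := SLop_chain_real Ss bs.
(* Both sides are continuous and agree almost everywhere; the radius 1 is arbitrary. *)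
have phiE x : Re (f x) + Re (g x) = phi 0%N x.
  have : Re (f x) + Re (g x) - phi 0%N x = 0.
    apply: (@ae_eq0_ball _ (fun x => Re (f x) + Re (g x) - phi 0%N x) x 1).
    - move=> y; apply: cvgB; first by apply: cvgD; [exact: cf|exact: cg].
      by have [ac _ _ _ _] := chain 0%N; exact: real_AC_continuous.
    - apply: aeS (eqphi 0%N) => y <- _.
      by rewrite /s Re_lin /= u0 w0 mul1r mul0r subr0 subrr.
    - by rewrite subrr normr0.
  by move/eqP; rewrite subr_eq0 => /eqP.
move=> x; rewrite phiE.
apply: (@unique_continuation _ _ _ _ _ _ _ c0 pc (exprn_gt0 2 O0) chain t r r0) => y yr.
by rewrite -phiE fg0.
Qed.

End sturm_liouville.

(** * Determination of a real function up to sign *)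

Theorem mainTheorem1 (R : realType) (N : nat) (p : R -> R) (hp : PC N p)
    (Omega : R) (hOmega : 0 < Omega) (f g : R -> R[i])
    (hf : PW Omega p f) (hg : PW Omega p g)
    (f_real : forall x : R, complex.Im (f x) = 0)
    (g_real : forall x : R, complex.Im (g x) = 0)
    (hfg : forall x : R, `|f x| = `|g x|) :
  (forall x : R, f x = g x) \/ (forall x : R, f x = - g x).
Proof.
(* For real values the complex norm is the absolute value of the real part, so equal moduli give
   equal squares. *)
have sqE x : complex.Re (f x) ^+ 2 = complex.Re (g x) ^+ 2.
  have := hfg x; have := f_real x; have := g_real x.
  case: (f x) => a b; case: (g x) => c d /= -> ->.
  rewrite !normc_def /= !expr0n /= !addr0 !sqrtr_sqr => -[].
  by move=> h; rewrite -(real_normK (num_real a)) h real_normK ?num_real.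
have [[t nt]|H] := pselect (exists t, complex.Re (f t) != complex.Re (g t)).
- right.
  have [cf _ _ _] := hf; have [cg _ _ _] := hg.
  have /nbhs_ballP[r /= r0 rP] : \forall x \near t, complex.Re (f x) - complex.Re (g x) != 0.
    have cd : complex.Re (f x) - complex.Re (g x) @[x --> t] -->
        complex.Re (f t) - complex.Re (g t) by exact: cvgB (cf t) (cg t).
    have d0 : 0 < `|complex.Re (f t) - complex.Re (g t)|.
      by rewrite normr_gt0 subr_eq0.
    move/cvgrPdist_lt: cd => /(_ _ d0); apply: filterS => y.
    by apply: contraTneq => E; rewrite E subr0 ltxx.
  have sum0 := PW_add_unique_continuation hp hOmega hf hg r0.
  have {}sum0 : forall x, complex.Re (f x) + complex.Re (g x) = 0.
    apply: (sum0 t) => x xt; have /rP d0 : ball t r x.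
      by rewrite /ball /= distrC.
    apply/eqP; have := sqE x; move/eqP; rewrite -subr_eq0 subr_sqr mulf_eq0.
    by rewrite (negbTE d0).
  move=> x; have := sum0 x; have := f_real x; have := g_real x.
  case: (f x) => a b; case: (g x) => c d /= -> -> /eqP.
  by rewrite addr_eq0 => /eqP ->; congr Complex; rewrite oppr0.
- left=> x; have : complex.Re (f x) = complex.Re (g x).
    by apply/eqP/negPn/negP => ?; apply: H; exists x.
  have := f_real x; have := g_real x.
  by case: (f x) => a b; case: (g x) => c d /= -> -> ->.
Qed.
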